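(* Let $(Z,\mathcal{Z},\mu)$ be a probability space and let $\{\xi_z\}_{z\in Z}$ be a family of real random variables such that for every Borel set $A\subset\mathbb{R}$ the function $z\mapsto \mathbf{P}(\xi_z\in A)$ is $\mu$-measurable. Suppose there is a constant $\sigma\in(0,\infty)$ such that every $\xi_z$, $z\in Z$, is strictly subgaussian with the same subgaussian norm $\|\xi_z\|_{\mathrm{Sub}}=\sigma$. Let $\nu$ be a random variable whose distribution is the mixture of the distributions of the $\xi_z$ with respect to $\mu$, i.e. $\mathbf{P}(\nu\in A)=\int_Z \mathbf{P}(\xi_z\in A)\,\mu(dz)$ for every Borel set $A\subset\mathbb{R}$. Then $\nu$ is strictly subgaussian and $\|\nu\|_{\mathrm{Sub}}=\sigma$.
   Context: A real random variable $\xi$ with $\mathbf{E}\xi=0$ is called subgaussian if there is $\tau\ge 0$ such that $\mathbf{E}e^{\lambda\xi}\le e^{\lambda^2\tau^2/2}$ for all $\lambda\in\mathbb{R}$; the smallest such $\tau$ is its subgaussian norm $\|\xi\|_{\mathrm{Sub}}$. A centered subgaussian random variable $\xi$ is called strictly subgaussian if $\mathbf{E}e^{\lambda\xi}\le e^{\lambda^2\sigma^2(\xi)/2}$ for all $\lambda\in\mathbb{R}$, where $\sigma^2(\xi)=\mathrm{Var}(\xi)$; equivalently, $\mathbf{E}\xi=0$ and $\|\xi\|_{\mathrm{Sub}}=\sigma(\xi)=(\mathbf{E}\xi^2)^{1/2}$. *)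

(* Defs.v *)
From mathcomp Require Import all_boot all_order all_algebra.
From mathcomp Require Import all_classical all_reals all_analysis.
From mathcomp Require Import measurable_realfun.
Set Implicit Arguments.
Unset Strict Implicit.
Unset Printing Implicit Defensive.
Import Order.TTheory GRing.Theory Num.Theory.
Import numFieldNormedType.Exports.
Local Open Scope classical_set_scope.
Local Open Scope ring_scope.

Section subgaussian.
Context (d : measure_display) (T : measurableType d) (R : realType).
Variables (P : probability T R) (X : {RV P >-> R}).

Definition subgaussian_bounds : set R :=
  [set tau | 0 <= tau /\ forall lambda : R,
     ('M_P X lambda <= (expR (lambda ^+ 2 * tau ^+ 2 / 2))%:E)%E].

(* A null expectation forces integrability: since +oo - +oo = -oo in \bar R,
   the expectation is finite only if the positive and the negative part of X
   both have a finite integral. *)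
Definition subgaussian : Prop :=
  'E_P[X]%E = 0%E /\ subgaussian_bounds !=set0.

(* The infimum is attained when X is subgaussian (subgaussian_norm_least);
   otherwise it is the dummy value inf set0 = 0. *)
Definition subgaussian_norm : R := inf subgaussian_bounds.

(* A subgaussian X has a finite variance, so fine loses nothing. *)
Definition strictly_subgaussian : Prop :=
  subgaussian /\ forall lambda : R,
    ('M_P X lambda <= (expR (lambda ^+ 2 * fine 'V_P[X] / 2))%:E)%E.

Lemma subgaussian_norm_least : subgaussian ->
  subgaussian_bounds subgaussian_norm /\
  forall tau, subgaussian_bounds tau -> subgaussian_norm <= tau.
Proof.
move=> [_ S0].
have lbS : lbound subgaussian_bounds 0 by move=> t [].
have N0 : 0 <= subgaussian_norm by exact: lb_le_inf.
split; last by move=> t St; apply: ge_inf => //; exists 0.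
split => // l; have [t0 [t00 /(_ l) Ml]] := S0.
have M0 : (0 <= 'M_P X l)%E.
  rewrite /mmt_gen_fun unlock; apply: integral_ge0 => x _.
  by rewrite lee_fin expR_ge0.
have Mf : 'M_P X l \is a fin_num by rewrite ge0_fin_numE// (le_lt_trans Ml) ?ltry.
rewrite -(fineK Mf) lee_fin; set m := fine _.
have [m1|m1] := leP m 1.
  by rewrite (le_trans m1)// -[leLHS]expR0 ler_expR divr_ge0// mulr_ge0// sqr_ge0.
have mpos : 0 < m by rewrite (lt_trans ltr01).
have key t : subgaussian_bounds t -> ln m <= l ^+ 2 * t ^+ 2 / 2.
  move=> [_ /(_ l)]; rewrite -{1}(fineK Mf) lee_fin => h.
  by rewrite -ler_expR lnK ?posrE.
have lnm : 0 < ln m by rewrite ln_gt0.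
have [l0|l0] := eqVneq l 0.
  have [t Ht] := S0.
  by move: (key t Ht); rewrite l0 expr0n/= !mul0r leNgt lnm.
have l2 : 0 < l ^+ 2 by rewrite exprn_even_gt0.
rewrite -[leLHS](lnK (_ : m \in Num.pos)) ?posrE// ler_expR.
rewrite ler_pdivlMr// -ler_pdivrMl//.
set c := _ * _; have c0 : 0 <= c by rewrite !mulr_ge0 ?invr_ge0 ?(ltW l2) ?(ltW lnm).
rewrite -(sqr_sqrtr c0) ler_pXn2r ?nnegrE ?sqrtr_ge0//.
apply: lb_le_inf => // t St; rewrite -(ger0_norm St.1) -sqrtr_sqr ler_wsqrtr//.
by rewrite ler_pdivrMl// -ler_pdivlMr//; exact: key.
Qed.

End subgaussian.

(* Measurability with respect to the mu-completion of the sigma-algebra of Z.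
   For such a nonnegative f, \int[mu]_z f z, a supremum over simple functions
   below f, is the integral of f against the completion of mu. *)
Definition mu_measurable (d : measure_display) (Z : measurableType d)
    (R : realType) (mu : probability Z R) (f : Z -> \bar R) : Prop :=
  forall B : set (\bar R), measurable B -> completed_algebra_gen mu (f @^-1` B).

(* Main.v *)
Require Import Defs.
From mathcomp Require Import all_boot all_order all_algebra.
From mathcomp Require Import all_classical all_reals all_analysis.
From mathcomp Require Import measurable_realfun ring lra.
Import Order.TTheory GRing.Theory Num.Theory.
Import numFieldNormedType.Exports.
Local Open Scope classical_set_scope.
Local Open Scope ring_scope.

(* Lower integrals are superadditive, so a bound [E f(xi_z) <= c] valid for all
   [z] passes to the mixture for every measurable [f >= 0].  For
   [f x = e^(l x)] this gives the moment generating function bound with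
   parameter [sigma], hence [E nu = 0] and [Var nu <= sigma^2] by expanding at
   [l = 0].  For the reverse inequality, an upper bound on a nonnegative
   function containing [- x^2] is needed:
   [f x = 3/4 (e^(l x) + e^(- l x)) - (l x)^2] is nonnegative, and
   [E f(xi_z) <= 3/2 e^(l^2 sigma^2 / 2) - l^2 sigma^2] while
   [E f(nu) >= 3/2 - l^2 Var nu / 4]; comparing the terms of order [l^2] yields
   [sigma^2 <= Var nu].  So [Var nu = sigma^2], and any subgaussian bound [tau]
   of [nu] satisfies [Var nu <= tau^2]. *)

(** * Elementary inequalities for the exponential *)

Lemma expR_ge1DxDsqr (R : realType) (x : R) :
  0 <= x -> 1 + x + x ^+ 2 / 2 <= expR x.
Proof.
move=> x0; have -> : 1 + x + x ^+ 2 / 2 = series (exp_coeff x) 3%N.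
  rewrite /series/= !big_nat_recr//= big_geq//.
  by rewrite /exp_coeff/= expr0 expr1 add0r !divr1.
apply: nondecreasing_cvgn_le; last exact: is_cvg_series_exp_coeff.
by apply: nondecreasing_series => n _ _; exact: exp_coeff_ge0.
Qed.

(** With [y = x / 2], [e^x + e^-x - 2] is the square of [e^y - e^-y], which is at least [2 y] for
    [y >= 0]. *)
Lemma expRDexpRN_ge (R : realType) (x : R) : 2 + x ^+ 2 <= expR x + expR (- x).
Proof.
wlog x0 : x / 0 <= x => [H|].
  have [/H//|/ltW] := leP 0 x; rewrite -oppr_ge0 => /H.
  by rewrite sqrrN opprK [leRHS]addrC.
have -> : x = x / 2 + x / 2 by lra.
set y := x / 2; have y0 : 0 <= y by rewrite divr_ge0.
rewrite opprD !expRD expRN.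
have := expR_ge1DxDsqr _ _ y0; have := expR_gt0 y; set a := expR y => a0 ya.
(* Multiplied by [a], this reads [1 + y^2 <= (a - y)^2], and [a - y >= 1 + y^2 / 2]. *)
have h : 2 * y <= a - a^-1.
  rewrite -(ler_pM2r a0) mulrBl mulVf ?gt_eqF//; nra.
have -> : a * a + a^-1 * a^-1 = (a - a^-1) ^+ 2 + 2.
  by field; rewrite gt_eqF.
have : (2 * y) ^+ 2 <= (a - a^-1) ^+ 2 by rewrite ler_sqr// nnegrE; nra.
nra.
Qed.

(* The factor only has to be less than 1: then the [x^2] terms of
   [3/4 (e^x + e^-x) - x^2] keep a negative coefficient. *)
Lemma sqr_le_expRDexpRN (R : realType) (x : R) :
  x ^+ 2 <= 3 / 4 * (expR x + expR (- x)).
Proof.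
have -> : x = x / 2 + x / 2 by lra.
set y := x / 2; rewrite opprD !expRD expRN.
have := expRDexpRN_ge R y; rewrite expRN; have := expR_gt0 y.
set a := expR y => a0 ya.
have -> : a * a + a^-1 * a^-1 = (a + a^-1) ^+ 2 - 2.
  by field; rewrite gt_eqF.
have : (2 + y ^+ 2) ^+ 2 <= (a + a^-1) ^+ 2.
  by rewrite ler_sqr// nnegrE; have := sqr_ge0 y; lra.
(* Since [x^2 = 4 y^2], what remains is [3/4 y^4 - y^2 + 3/2 >= 0], a quadratic in [y^2] with
   negative discriminant. *)
move: (sqr_ge0 y); nra.
Qed.

(** Replaces the passage to the limit [l -> 0] in the comparisons of Taylor coefficients below. *)
Lemma ler_of_forall_small (R : realFieldType) (a b c : R) :
  (forall l, 0 < l < 1 -> a <= b + l * c) -> a <= b.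
Proof.
move=> h; apply/ler_addgt0Pr => e e0.
pose d := 1 + e + `|c|.
have d0 : 0 < d by rewrite /d -addrA ltr_pwDl// addr_ge0// ltW.
apply: (le_trans (h (e / d) _)).
  by rewrite divr_gt0//= ltr_pdivrMr// mul1r /d; have := normr_ge0 c; lra.
rewrite lerD2l mulrAC ler_pdivrMr//; apply: ler_wpM2l; first exact: ltW.
by apply: (le_trans (ler_norm c)); rewrite /d; lra.
Qed.

(** * Lower integrals and mixtures of measures *)

Section lower_integral.
Import HBNNSimple.

(** The integral is a supremum over simple functions below [g]; a sequence of them approaches it,
    and their countable pointwise supremum is still measurable and below [g]. *)
Lemma integral_measurable_minorant (R : realType) (d : measure_display)
    (T : measurableType d) (mu : {measure set T -> \bar R}) (g : T -> \bar R) :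
  (forall x, 0 <= g x)%E ->
  exists phi : T -> \bar R, [/\ measurable_fun setT phi,
    (forall x, 0 <= phi x <= g x)%E & (\int[mu]_x g x <= \int[mu]_x phi x)%E].
Proof.
move=> g0; rewrite (ge0_integralTE mu g0).
set S := [set _ | _ in _].
have SN0 : S != set0.
  by apply/set0P; exists (sintegral mu (@nnsfun0 _ T R)); exists (@nnsfun0 _ T R).
have [u Su ucvg] := ereal_sup_seq SN0.
have /choice[h hu] : forall n, exists h : {nnsfun T >-> R},
    (forall x, (h x)%:E <= g x)%E /\ sintegral mu h = u n.
  by move=> n; have [h ? ?] := Su n; exists h.
pose phi x := ereal_sup [set ((h n x)%:E)%E | n in setT].
have hphi n x : ((h n x)%:E <= phi x)%E by apply: ereal_sup_ubound; exists n.
have phi0 x : (0 <= phi x)%E by apply: le_trans (hphi 0%N x); rewrite lee_fin.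
have mphi : measurable_fun setT phi.
  have -> : phi = (fun x => esups (fun n => (h n x)%:E) 0%N).
    apply/funext => x; rewrite /phi /esups /sdrop/=; congr ereal_sup.
    by apply/seteqP; split=> _ [n _ <-]; exists n.
  apply: (@measurable_fun_esups _ _ _ setT (fun n x => (h n x)%:E)).
  by move=> n; exact/measurable_EFinP.
exists phi; split => //.
  by move=> x; rewrite phi0; apply: ge_ereal_sup => _ [n _ <-]; exact: (hu n).1.
have -> : ereal_sup S = limn u by apply/esym/cvg_lim.
apply: lime_le; first by apply/cvg_ex; eexists; exact: ucvg.
apply: nearW => n; rewrite -(hu n).2 -integralT_nnsfun.
apply: ge0_le_integral => //.
  by move=> x _; rewrite lee_fin.
exact/measurable_EFinP.
Qed.

(* No measurability of [z |-> m z A] is assumed: [\int] of a nonnegative function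
   is its lower integral, so measurable minorants can be summed instead. *)
Lemma mixture_integral_le (R : realType) (dZ dY : measure_display)
    (Z : measurableType dZ) (Y : measurableType dY) (mu : probability Z R)
    (m : Z -> {measure set Y -> \bar R}) (n : {measure set Y -> \bar R})
    (f : Y -> \bar R) (c : R) :
  (forall A, measurable A -> n A = \int[mu]_z m z A)%E ->
  (forall y, 0 <= f y)%E -> 0 <= c -> measurable_fun setT f ->
  (forall z, \int[m z]_y f y <= c%:E)%E -> (\int[n]_y f y <= c%:E)%E.
Proof.
move=> nE f0 c0 mf fc; rewrite (ge0_integralTE n f0).
apply: ge_ereal_sup => _ [h /= hf <-].
have /choice[phi phiP] : forall r : R, exists phi : Z -> \bar R,
    [/\ measurable_fun setT phi,
      (forall z, 0 <= phi z <= m z (h @^-1` [set r]))%E &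
      (\int[mu]_z m z (h @^-1` [set r]) <= \int[mu]_z phi z)%E].
  by move=> r; apply: integral_measurable_minorant.
have mphi r : measurable_fun setT (phi r) by have [] := phiP r.
have phi0 r z : (0 <= phi r z)%E by have [_ /(_ z)/andP[]] := phiP r.
have phile r z : (phi r z <= m z (h @^-1` [set r]))%E.
  by have [_ /(_ z)/andP[]] := phiP r.
have r0 r : r \in range h -> 0 <= r by move=> /[!inE] -[x _ <-].
rewrite sintegralE.
(* [Num.max r 0] is [r] on the range of [h]; it makes the terms nonnegative for every real [r], as
   the exchange of sum and integral demands. *)
apply: (@le_trans _ _ (\sum_(r \in range h) \int[mu]_z ((Num.max r 0)%:E * phi r z)))%E.
  apply: lee_fsum => // r /mem_set rh.
  rewrite ge0_integralZl// ?lee_fin ?le_max ?lexx ?orbT//.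
  rewrite nE//; have [_ _ ?] := phiP r.
  have -> : Num.max r 0 = r by apply/max_idPl; exact: r0.
  by rewrite lee_wpmul2l// lee_fin r0.
rewrite -ge0_integral_fsum//; last 2 first.
- by move=> r; apply: measurable_funeM.
- by move=> r z _; rewrite mule_ge0// lee_fin le_max lexx orbT.
(* As [mu] has mass 1, it suffices to bound the integrand by [c] at each [z], where it is at most
   the integral of [h], hence of [f], against [m z]. *)
have -> : c%:E = (\int[mu]_z (cst c%:E) z)%E.
  by rewrite integral_cst//= probability_setT mule1.
apply: ge0_le_integral => //=.
- move=> z _; apply: fsume_ge0 => r _.
  by rewrite mule_ge0// lee_fin le_max lexx orbT.
- apply: emeasurable_fsum => // r; exact: measurable_funeM.
move=> z _; apply: le_trans (fc z).
apply: (@le_trans _ _ (\int[m z]_y (h y)%:E)%E); last first.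
  apply: ge0_le_integral => //=; first by move=> y _; rewrite lee_fin.
  exact/measurable_EFinP.
rewrite integralT_nnsfun sintegralE; apply: lee_fsum => // r /mem_set rh.
have -> : Num.max r 0 = r by apply/max_idPl; exact: r0.
by rewrite lee_wpmul2l// lee_fin r0.
Qed.

End lower_integral.

(** * Moments controlled by the moment generating function *)

Section moments.
Context (R : realType) (d : measure_display) (T : measurableType d).
Variables (P : probability T R) (X : {RV P >-> R}).

Lemma measurable_expR_scale (l : R) :
  measurable_fun setT (fun w => (expR (l * X w))%:E).
Proof.
apply/measurable_EFinP; apply: measurableT_comp => //.
exact: measurable_funM.
Qed.

Lemma measurable_scale_sqr (a : R) :
  measurable_fun setT (fun w => (a * X w ^+ 2)%:E).
Proof.
apply/measurable_EFinP; apply: measurable_funM => //.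
exact: measurable_funX.
Qed.

Lemma mmt_gen_funE (l : R) :
  'M_P X l = (\int[P]_w (expR (l * X w))%:E)%E.
Proof.
by rewrite /mmt_gen_fun unlock; apply: eq_integral => w _ /=; rewrite mulrC.
Qed.

Lemma variance_centered :
  ('E_P[X] = 0 -> 'V_P[X] = \int[P]_w (X w ^+ 2)%:E)%E.
Proof.
move=> EX; rewrite /variance covariance.unlock EX expectation.unlock.
apply: eq_integral => w _ /=.
by rewrite !fctE /= subr0 expr2.
Qed.

Lemma ge0_integral_scale_sqr (a : R) : 0 <= a ->
  (\int[P]_w (a * X w ^+ 2)%:E = a%:E * \int[P]_w (X w ^+ 2)%:E)%E.
Proof.
move=> a0; under eq_integral do rewrite EFinM.
rewrite ge0_integralZl//; last by move=> w _; rewrite lee_fin sqr_ge0.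
by have := measurable_scale_sqr 1; under eq_fun do rewrite mul1r.
Qed.

(** Integrates [expRDexpRN_ge]. Only nonnegative functions occur, so infinite values are allowed and
    finiteness of the second moment can be deduced from it. *)
Lemma mmt_gen_funD_ge (l : R) :
  (2%:E + (l ^+ 2)%:E * \int[P]_w (X w ^+ 2)%:E <=
    'M_P X l + 'M_P X (- l)%R)%E.
Proof.
rewrite !mmt_gen_funE -ge0_integral_scale_sqr ?sqr_ge0//.
rewrite -[X in (X + _ <= _)%E]mule1 -(probability_setT P) -integral_cst//.
have e0 (k : R) w : (0 <= (expR (k * X w))%:E)%E by rewrite lee_fin expR_ge0.
have q0 w : (0 <= (l ^+ 2 * X w ^+ 2)%:E)%E.
  by rewrite lee_fin mulr_ge0 ?sqr_ge0.
have me := measurable_expR_scale; have mq := measurable_scale_sqr.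
have c0 w : (0 <= cst (2%:E : \bar R) w :> \bar R)%E by rewrite lee_fin.
rewrite -!ge0_integralD//.
apply: ge0_le_integral => //.
- by move=> w _; apply: adde_ge0.
- by exact: emeasurable_funD.
- by exact: emeasurable_funD.
move=> w _; rewrite /= -!EFinD lee_fin mulNr -exprMn; exact: expRDexpRN_ge.
Qed.

Section subgaussian_bound.
Variables (tau : R) (Xtau : forall l : R,
  ('M_P X l <= (expR (l ^+ 2 * tau ^+ 2 / 2))%:E)%E).

Lemma second_moment_le : (\int[P]_w (X w ^+ 2)%:E <= (tau ^+ 2)%:E)%E.
Proof.
set V := (\int[P]_w _)%E.
have V0 : (0 <= V)%E by apply: integral_ge0 => w _; rewrite lee_fin sqr_ge0.
have key (l : R) : (2%:E + (l ^+ 2)%:E * V <=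
    (2 * expR (l ^+ 2 * tau ^+ 2 / 2))%:E)%E.
  apply: (le_trans (mmt_gen_funD_ge l)).
  rewrite mulrDl mul1r EFinD; apply: leeD; first exact: Xtau.
  by have := Xtau (- l); rewrite sqrrN.
have Vfin : V \is a fin_num.
  rewrite ge0_fin_numE// ltNge leye_eq; apply/negP => /eqP Vy.
  by have := key 1; rewrite Vy expr1n mul1e leye_eq.
move: V0 key; rewrite -(fineK Vfin) !lee_fin; move: (fine V) => v v0 key.
apply: (@ler_of_forall_small _ _ _ (v * tau ^+ 2 / 2)) => l /andP[l0 l1].
have {key} := key l; rewrite -EFinM -EFinD lee_fin => key.
set s := l ^+ 2 * tau ^+ 2 / 2 in key.
(* The bound [1 - s <= e^-s] turns the exponential estimate into a polynomial one, to be divided by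
   [l^2]. *)
have h : (2 + l ^+ 2 * v) * (1 - s) <= 2.
  apply: (@le_trans _ _ ((2 + l ^+ 2 * v) * expR (- s))).
    apply: ler_wpM2l; first by rewrite addr_ge0// mulr_ge0 ?sqr_ge0.
    exact: expR_ge1Dx.
  by rewrite expRN ler_pdivrMr// expR_gt0.
have l20 : 0 < l ^+ 2 by rewrite exprn_gt0.
have {h} : v * (1 - s) <= tau ^+ 2.
  by rewrite -(ler_pM2l l20) /s; rewrite /s in h; lra.
(* The error is of order [l^2]; [l < 1] makes it linear, as [ler_of_forall_small] expects. *)
have : l * (l * (v * tau ^+ 2 / 2)) <= 1 * (l * (v * tau ^+ 2 / 2)).
  apply: ler_wpM2r; last exact: ltW.
  by rewrite mulr_ge0 ?(ltW l0)// divr_ge0// mulr_ge0 ?sqr_ge0.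
by rewrite /s; lra.
Qed.

Lemma integrable_of_mmt_bound : P.-integrable setT (EFin \o X).
Proof.
apply: (@le_integrable _ _ _ P setT measurableT _
    (fun w => (1 * X w ^+ 2 + 1)%:E)).
- by apply/measurable_EFinP.
- move=> w _ /=; rewrite lee_fin [leRHS]ger0_norm; last first.
    by rewrite mul1r addr_ge0 ?sqr_ge0.
  rewrite mul1r -[X w ^+ 2]real_normK ?num_real//.
  by have := sqr_ge0 (`|X w| - 1); have := normr_ge0 (X w); nra.
under eq_fun do rewrite EFinD; apply: integrableD => //; last first.
  exact: finite_measure_integrable_cst.
apply/integrableP; split; first exact: measurable_scale_sqr.
apply: le_lt_trans (ltry (tau ^+ 2)); apply: le_trans second_moment_le.
rewrite le_eqVlt; apply/orP; left; apply/eqP; apply: eq_integral => w _.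
by rewrite mul1r gee0_abs// lee_fin sqr_ge0.
Qed.

(** Integrating [1 + l x <= e^(l x)] gives [1 + l E X <= e^(l^2 tau^2 / 2)]; the terms of order [l],
    for both signs of [l], force [E X = 0]. *)
Lemma expectation_eq0_of_mmt_bound : ('E_P[X] = 0)%E.
Proof.
have EX : 'E_P[X]%E \is a fin_num.
  by rewrite unlock; apply: integrable_fin_num => //; exact: integrable_of_mmt_bound.
rewrite -(fineK EX); congr EFin; move EXm : (fine _) => m.
have key (l : R) : 1 + l * m <= expR (l ^+ 2 * tau ^+ 2 / 2).
  rewrite -lee_fin; apply: le_trans (Xtau l); rewrite mmt_gen_funE.
  have -> : (1 + l * m)%:E = (\int[P]_w (1 + l * X w)%:E)%E.
    under [RHS]eq_integral do rewrite EFinD EFinM.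
    rewrite integralD//; last 2 first.
    - exact: finite_measure_integrable_cst.
    - by apply: integrableZl => //; exact: integrable_of_mmt_bound.
    rewrite integral_cst// [X in (_ * X + _)%E](probability_setT P) mule1.
    rewrite integralZl//; last exact: integrable_of_mmt_bound.
    by rewrite EFinD EFinM -EXm fineK// unlock.
  apply: le_integral => //.
  - rewrite (_ : (fun _ => _) = ((fun w => 1%:E + l%:E * (X w)%:E))%E).
      apply: integrableD => //; first exact: finite_measure_integrable_cst.
      by apply: integrableZl => //; exact: integrable_of_mmt_bound.
    by apply/funext => w; rewrite EFinD EFinM.
  - apply/integrableP; split; first exact: measurable_expR_scale.
    rewrite (_ : (\int[P]_x _)%E = 'M_P X l).
      by apply: le_lt_trans (Xtau l) _; exact: ltry.
    rewrite mmt_gen_funE; apply: eq_integral => w _.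
    by rewrite gee0_abs// lee_fin expR_ge0.
  - by move=> w _; rewrite lee_fin expR_ge1Dx.
have aux (u : R) : (forall l, 0 < l -> 1 + l * u <= expR (l ^+ 2 * tau ^+ 2 / 2)) ->
    u <= 0.
  (* The assumption [0 < u] is kept while [u <= 0] is proved: multiplying [1 - s <= e^-s] by
     [1 + l u] requires it. *)
  move=> H; rewrite leNgt; apply/negP => u0; move: (u0); apply/negP; rewrite -leNgt.
  apply: (@ler_of_forall_small _ _ _ ((1 + u) * tau ^+ 2 / 2)) => l /andP[l0 l1].
  have {H} := H l l0; set s := _ / 2 => H.
  have h : (1 + l * u) * (1 - s) <= 1.
    apply: (@le_trans _ _ ((1 + l * u) * expR (- s))).
      apply: ler_wpM2l; first by rewrite addr_ge0// mulr_ge0// ltW.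
      exact: expR_ge1Dx.
    by rewrite expRN ler_pdivrMr ?expR_gt0// mul1r.
  have {h} : u * (1 - s) <= l * tau ^+ 2 / 2.
    by rewrite -(ler_pM2l l0) /s; rewrite /s in h; lra.
  have : l * (l * (u * tau ^+ 2 / 2)) <= 1 * (l * (u * tau ^+ 2 / 2)).
    apply: ler_wpM2r; last exact: ltW.
    by rewrite mulr_ge0 ?(ltW l0)// divr_ge0// mulr_ge0 ?sqr_ge0// ltW.
  by rewrite /s; lra.
apply/eqP; rewrite eq_le aux//= -oppr_le0; apply: aux => l l0.
by have := key (- l); rewrite sqrrN mulNr mulrN.
Qed.

End subgaussian_bound.
End moments.

(** * Transfer of moment bounds to the mixture *)

Section mixture.
Context (R : realType) (dZ d d' : measure_display).
Context (Z : measurableType dZ) (mu : probability Z R).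
Context (Omega : measurableType d) (P : probability Omega R).
Variable xi : Z -> {RV P >-> R}.
Context (Omega' : measurableType d') (P' : probability Omega' R).
Variable nu : {RV P' >-> R}.
Hypothesis nu_mixture : forall A : set R, measurable A ->
  P' (nu @^-1` A) = (\int[mu]_z P (xi z @^-1` A))%E.

(** A change of variables reduces this to [mixture_integral_le] for the laws of [xi z] and [nu] on
    the real line. *)
Lemma mixture_moment_le (f : R -> R) (c : R) : measurable_fun setT f ->
  (forall x, 0 <= f x) -> 0 <= c ->
  (forall z, \int[P]_w (f (xi z w))%:E <= c%:E)%E ->
  (\int[P']_w (f (nu w))%:E <= c%:E)%E.
Proof.
move=> mf f0 c0 fc.
have mEf : measurable_fun setT (EFin \o f) by exact/measurable_EFinP.
have Ef0 y : (0 <= (EFin \o f) y)%E by rewrite /= lee_fin.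
have := @mixture_integral_le _ _ _ _ _ mu
  (fun z => distribution P (xi z)) (distribution P' nu) (EFin \o f) c.
rewrite ge0_integral_distribution//; apply => //.
by move=> z; rewrite ge0_integral_distribution//; exact: fc.
Qed.

Variable sigma : R.
Hypothesis xi_bound : forall z l,
  ('M_P (xi z) l <= (expR (l ^+ 2 * sigma ^+ 2 / 2))%:E)%E.

Lemma mixture_mmt_gen_fun_le (l : R) :
  ('M_P' nu l <= (expR (l ^+ 2 * sigma ^+ 2 / 2))%:E)%E.
Proof.
rewrite mmt_gen_funE; apply: (@mixture_moment_le (fun x => expR (l * x))).
- by apply: measurableT_comp => //; exact: measurable_funM.
- by move=> x; exact: expR_ge0.
- exact: expR_ge0.
- by move=> z; rewrite -mmt_gen_funE.
Qed.

(** The square is added back instead of subtracted, so that additivity for nonnegative functions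
    suffices, without integrability. *)
Lemma integral_cosh_sub_sqr (dT : measure_display) (T : measurableType dT)
    (Q : probability T R) (X : {RV Q >-> R}) (l : R) :
  (\int[Q]_w (3 / 4 * (expR (l * X w) + expR (- (l * X w))) - (l * X w) ^+ 2)%:E
     + (l ^+ 2)%:E * \int[Q]_w (X w ^+ 2)%:E =
   (3 / 4)%:E * ('M_Q X l + 'M_Q X (- l)%R))%E.
Proof.
have me := measurable_expR_scale _ _ _ _ X.
have mq := measurable_scale_sqr _ _ _ _ X.
have e0 (k : R) w : (0 <= (expR (k * X w))%:E)%E by rewrite lee_fin expR_ge0.
have q0 w : (0 <= (l ^+ 2 * X w ^+ 2)%:E)%E.
  by rewrite lee_fin mulr_ge0 ?sqr_ge0.
rewrite -ge0_integral_scale_sqr ?sqr_ge0// !mmt_gen_funE.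
have F0 w : (0 <= (3 / 4 * (expR (l * X w) + expR (- (l * X w))) -
    (l * X w) ^+ 2)%:E)%E by rewrite lee_fin subr_ge0 sqr_le_expRDexpRN.
have mF : measurable_fun setT (fun w =>
    (3 / 4 * (expR (l * X w) + expR (- (l * X w))) - (l * X w) ^+ 2)%:E).
  rewrite (_ : (fun _ => _) = (fun w => (3 / 4)%:E *
      ((expR (l * X w))%:E + (expR (- l * X w))%:E) - (l ^+ 2 * X w ^+ 2)%:E)%E).
    apply: emeasurable_funB => //; apply: measurable_funeM.
    exact: emeasurable_funD.
  by apply/funext => w; rewrite -EFinD mulNr exprMn.
rewrite -ge0_integralD//.
rewrite -ge0_integralD// -ge0_integralZl//; last 2 first.
- exact: emeasurable_funD.
- by move=> w _; exact: adde_ge0.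
apply: eq_integral => w _.
by rewrite -!EFinD -EFinM mulNr exprMn; congr EFin; ring.
Qed.

Lemma mixture_second_moment_ge :
  (forall z, (sigma ^+ 2)%:E <= \int[P]_w (xi z w ^+ 2)%:E)%E ->
  ((sigma ^+ 2)%:E <= \int[P']_w (nu w ^+ 2)%:E)%E.
Proof.
move=> xi2; set V := (\int[P']_w _)%E.
have V0 : (0 <= V)%E by apply: integral_ge0 => w _; rewrite lee_fin sqr_ge0.
have Vfin : V \is a fin_num.
  rewrite ge0_fin_numE//; apply: le_lt_trans (ltry (sigma ^+ 2)).
  exact/second_moment_le/mixture_mmt_gen_fun_le.
pose F (l x : R) := 3 / 4 * (expR (l * x) + expR (- (l * x))) - (l * x) ^+ 2.
have F0 l x : 0 <= F l x by rewrite subr_ge0 sqr_le_expRDexpRN.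
pose c (l : R) := 3 / 2 * expR (l ^+ 2 * sigma ^+ 2 / 2) - l ^+ 2 * sigma ^+ 2.
have xiF l z : (\int[P]_w (F l (xi z w))%:E <= (c l)%:E)%E.
  rewrite EFinB leeBrDr//.
  apply: (@le_trans _ _ (\int[P]_w (F l (xi z w))%:E +
     (l ^+ 2)%:E * \int[P]_w (xi z w ^+ 2)%:E)%E).
    by rewrite leeD2l// EFinM lee_wpmul2l// lee_fin sqr_ge0.
  rewrite integral_cosh_sub_sqr.
  apply: (@le_trans _ _ ((3 / 4)%:E * (expR (l ^+ 2 * sigma ^+ 2 / 2) +
     expR (l ^+ 2 * sigma ^+ 2 / 2))%:E)%E).
    apply: lee_wpmul2l; first by rewrite lee_fin divr_ge0.
    rewrite EFinD leeD// ?xi_bound//.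
    by have := xi_bound z (- l); rewrite sqrrN.
  by rewrite -EFinM lee_fin; lra.
(* The bound [c l] dominates the integral of a nonnegative function at one element of [Z], which is
   a pointed type. *)
have c0 l : 0 <= c l.
  rewrite -lee_fin; apply: le_trans (xiF l point).
  by apply: integral_ge0 => w _; rewrite lee_fin.
have nuF l : (\int[P']_w (F l (nu w))%:E <= (c l)%:E)%E.
  apply: mixture_moment_le => //.
  have ml : measurable_fun setT (fun x : R => l * x) by exact: measurable_funM.
  apply: measurable_funB; last exact: measurable_funX.
  apply: measurable_funM => //; apply: measurable_funD.
    exact: measurableT_comp.
  by apply: measurableT_comp => //; exact: measurable_funN.
have key l : ((3 / 4)%:E * (2%:E + (l ^+ 2)%:E * V) <=
    (c l)%:E + (l ^+ 2)%:E * V)%E.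
  apply: le_trans (leeD2r _ (nuF l)); rewrite integral_cosh_sub_sqr.
  apply: lee_wpmul2l; last exact: mmt_gen_funD_ge.
  by rewrite lee_fin divr_ge0.
move: V0 key; rewrite -(fineK Vfin) !lee_fin; move: (fine V) => v v0 key.
apply: (@ler_of_forall_small _ _ _ (2 * sigma ^+ 4)) => l /andP[l0 l1].
have {key} := key l; rewrite -!EFinM -!EFinD lee_fin /c.
set s := l ^+ 2 * sigma ^+ 2 / 2 => key.
have l20 : 0 < l ^+ 2 by rewrite exprn_gt0.
(* As [2 s = l^2 sigma^2], [key] says [3/2 + 2 s <= 3/2 e^s + l^2 v / 4]; divide by [e^s >= 1] and
   use [1 - s <= e^-s]. *)
have h : (3 / 2 + 2 * s) * (1 - s) <= 3 / 2 + l ^+ 2 * v / 4.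
  have s0 : 0 <= s by rewrite divr_ge0// mulr_ge0 ?sqr_ge0.
  have lv0 : 0 <= l ^+ 2 * v by apply: mulr_ge0 => //; exact: ltW.
  apply: (@le_trans _ _ ((3 / 2 + 2 * s) * expR (- s))).
    apply: ler_wpM2l; first by rewrite addr_ge0// mulr_ge0.
    exact: expR_ge1Dx.
  rewrite expRN ler_pdivrMr ?expR_gt0//.
  have es1 : 1 <= expR s by rewrite -expR0 ler_expR.
  have : l ^+ 2 * v * 1 <= l ^+ 2 * v * expR s by exact: ler_wpM2l.
  have hs : 2 * s = l ^+ 2 * sigma ^+ 2 by rewrite /s; field.
  lra.
(* The left side of [h] is [3/2 + s/2 - 2 s^2] and [s/2 = l^2 sigma^2 / 4], whence the division by
   [l^2 / 4]. *)
have {h} : sigma ^+ 2 <= v + 2 * l ^+ 2 * sigma ^+ 4.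
  have l24 : 0 < l ^+ 2 / 4 by rewrite divr_gt0.
  by rewrite -(ler_pM2l l24); rewrite /s in h; lra.
have : l * (l * (2 * sigma ^+ 4)) <= 1 * (l * (2 * sigma ^+ 4)).
  apply: ler_wpM2r; last exact: ltW.
  by rewrite mulr_ge0 ?(ltW l0)// mulr_ge0// exprn_even_ge0.
lra.
Qed.

End mixture.

(** * Variance and norm of the mixture *)

Theorem theorem2p1 (R : realType)
    (dZ : measure_display) (Z : measurableType dZ) (mu : probability Z R)
    (d : measure_display) (Omega : measurableType d) (P : probability Omega R)
    (xi : Z -> {RV P >-> R})
    (xi_measurable : forall A : set R, measurable A ->
       mu_measurable mu (fun z => P (xi z @^-1` A)))
    (sigma : R) (sigma_gt0 : 0 < sigma)
    (xi_strict : forall z, strictly_subgaussian (xi z))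
    (xi_norm : forall z, subgaussian_norm (xi z) = sigma)
    (d' : measure_display) (Omega' : measurableType d')
    (P' : probability Omega' R) (nu : {RV P' >-> R})
    (nu_mixture : forall A : set R, measurable A ->
       P' (nu @^-1` A) = (\int[mu]_z P (xi z @^-1` A))%E) :
  strictly_subgaussian nu /\ subgaussian_norm nu = sigma.
Proof.
have xi_bound z l : ('M_P (xi z) l <= (expR (l ^+ 2 * sigma ^+ 2 / 2))%:E)%E.
  by have [[_ M] _] := subgaussian_norm_least (xi_strict z).1; rewrite -(xi_norm z).
have xi_sqr z : ((sigma ^+ 2)%:E <= \int[P]_w (xi z w ^+ 2)%:E)%E.
  have [[EX _] MX] := xi_strict z.
  have V0 : 0 <= fine 'V_P[xi z] by apply: fine_ge0; exact: variance_ge0.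
  (* Strictness makes the standard deviation an admissible bound, and the norm is the least one. *)
  have sV : sigma <= Num.sqrt (fine 'V_P[xi z]).
    rewrite -(xi_norm z); apply: (subgaussian_norm_least (xi_strict z).1).2.
    by split => [|l]; rewrite ?sqrtr_ge0// sqr_sqrtr.
  rewrite -variance_centered//.
  have Vfin : 'V_P[xi z] \is a fin_num.
    rewrite ge0_fin_numE ?variance_ge0// variance_centered//.
    by apply: le_lt_trans (second_moment_le _ _ _ _ _ _ (xi_bound z)) _; exact: ltry.
  rewrite -(fineK Vfin) lee_fin -(sqr_sqrtr V0).
  by rewrite ler_sqr// nnegrE ?sqrtr_ge0// ltW.
have nu_bound l : ('M_P' nu l <= (expR (l ^+ 2 * sigma ^+ 2 / 2))%:E)%E.
  by apply: (mixture_mmt_gen_fun_le _ _ _ _ _ mu _ P xi);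
    [exact: nu_mixture|exact: xi_bound].
have nu_sqr : ((sigma ^+ 2)%:E <= \int[P']_w (nu w ^+ 2)%:E)%E.
  by apply: (mixture_second_moment_ge _ _ _ _ _ mu _ P xi);
    [exact: nu_mixture|exact: xi_bound|exact: xi_sqr].
have Enu := expectation_eq0_of_mmt_bound _ _ _ _ _ _ nu_bound.
have Vnu : 'V_P'[nu]%E = (sigma ^+ 2)%:E.
  apply/eqP; rewrite variance_centered// eq_le nu_sqr andbT.
  exact: second_moment_le nu_bound.
have nu_sub : subgaussian nu by split=> //; exists sigma; split; [exact: ltW|].
split; first by split=> // l; rewrite Vnu.
have [[N0 Nb] Nle] := subgaussian_norm_least nu_sub.
apply/eqP; rewrite eq_le Nle/=; last by split; [exact: ltW|].
(* The norm of [nu] is itself an admissible bound, so its square dominates the variance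
   [sigma^2]. *)
rewrite -ler_sqr ?nnegrE ?(ltW sigma_gt0)// -lee_fin -Vnu variance_centered//.
exact: second_moment_le Nb.
Qed.
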